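(* (i) Let $M,N$ be $\mathbb B$-modules and $f,g\in\mathrm{Hom}_{\mathbb B}(M,N)$. The sequence $0\underset{0}{\overset{0}{\rightrightarrows}}M\underset{g}{\overset{f}{\rightrightarrows}}N\underset{0}{\overset{0}{\rightrightarrows}}0$ in $\mathrm{Bmod}^2$ is strictly exact if and only if the pair $\phi=(f,g)$ is an isomorphism in $\mathrm{Bmod}^2$. (ii) For a $\mathbb B$-module $M$, the group of automorphisms $\mathrm{Aut}_{\mathrm{Bmod}^2}(M)$ is the semi-direct product of the $2$-group $\mathrm{Aut}^{(1)}_{\mathrm{Bmod}^2}(M)$ of decompositions $M=M_1\times M_2$ by the group of automorphisms of the $\mathbb B$-module $M$.
   Context: $\mathbb B=\{0,1\}$ is the Boolean semifield ($1+1=1$). A $\mathbb B$-module is a commutative monoid $(M,+,0)$ with $x+x=x$ for all $x$; morphisms are the monoid homomorphisms, added pointwise; the category is $\mathrm{Bmod}$. $\mathrm{Bmod}^2$ has $\mathbb B$-modules as objects, and morphisms $M\to N$ are pairs $(f,g)$ of morphisms in $\mathrm{Bmod}$, composed by $(f,g)\circ(f',g')=(f f'+g g',\,f g'+g f')$; the identity is $(\mathrm{id},0)$. For $\alpha_1,\alpha_2:L\to M$ and $\beta_1,\beta_2:M\to N$ put $B(\alpha_1,\alpha_2)=\{(\alpha_1(x)+\alpha_2(y),\alpha_2(x)+\alpha_1(y))\mid x,y\in L\}\subset M\times M$, $Z(\beta_1,\beta_2)=\{(u,v)\in M\times M\mid\beta_1(u)+\beta_2(v)=\beta_2(u)+\beta_1(v)\}$,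 and let $\Delta\subset M\times M$ be the diagonal. The sequence $L\underset{\alpha_2}{\overset{\alpha_1}{\rightrightarrows}}M\underset{\beta_2}{\overset{\beta_1}{\rightrightarrows}}N$ is strictly exact at $M$ if $B(\alpha_1,\alpha_2)+\Delta=Z(\beta_1,\beta_2)$; a longer sequence is strictly exact if it is so at every intermediate term. A decomposition $M=M_1\times M_2$ is a pair of submodules $M_1,M_2\subset M$ such that $M_1\times M_2\to M$, $(x_1,x_2)\mapsto x_1+x_2$, is an isomorphism; to it corresponds the morphism $(p_1,p_2):M\to M$ of $\mathrm{Bmod}^2$, where $p_j:M\to M_j\subset M$ are the associated projections. These pairs $(p_1,p_2)$ form a subgroup $\mathrm{Aut}^{(1)}_{\mathrm{Bmod}^2}(M)$ of $\mathrm{Aut}_{\mathrm{Bmod}^2}(M)$, abelian with every element of order dividing two. The group $\mathrm{Aut}_{\mathrm{Bmod}}(M)$ is viewed in $\mathrm{Aut}_{\mathrm{Bmod}^2}(M)$ via $\alpha\mapsto(\alpha,0)$, and acts on $\mathrm{Aut}^{(1)}_{\mathrm{Bmod}^2}(M)$ by conjugation; the semi-direct product is $\mathrm{Aut}^{(1)}_{\mathrm{Bmod}^2}(M)\rtimes\mathrm{Aut}_{\mathrm{Bmod}}(M)$ for this action. *)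

(* Defs.v *)
From HB Require Import structures.
From mathcomp Require Import all_boot ssralg boolp classical_sets.

Set Implicit Arguments.
Unset Strict Implicit.
Unset Printing Implicit Defensive.

Import GRing.Theory.
Local Open Scope classical_set_scope.
Local Open Scope ring_scope.

(* Over the Boolean semifield the scalar action is forced (0 x = 0, 1 x = x),
   so a B-module is exactly a commutative monoid in which x + x = x, and the
   B-linear maps are the monoid morphisms {additive M -> N}. *)
HB.mixin Record isBoolModule M of GRing.Nmodule M := {
  addxx : forall x : M, x + x = x
}.

#[short(type="bmodType")]
HB.structure Definition BoolModule := {M of GRing.Nmodule M & isBoolModule M}.

Definition zero_bmod : Type := unit.
HB.instance Definition _ := Choice.on zero_bmod.

Section ZeroBoolModule.
Let add (_ _ : zero_bmod) : zero_bmod := tt.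
Let addA : associative add. Proof. by []. Qed.
Let addC : commutative add. Proof. by []. Qed.
Let add0 : left_id (tt : zero_bmod) add. Proof. by case. Qed.
HB.instance Definition _ := GRing.isNmodule.Build zero_bmod addA addC add0.
Let addii (x : zero_bmod) : x + x = x. Proof. by case: x. Qed.
HB.instance Definition _ := isBoolModule.Build zero_bmod addii.
End ZeroBoolModule.

Section PairBoolModule.
Variables M N : bmodType.
Let pair_addxx (x : M * N) : x + x = x.
Proof. by case: x => x y; congr pair; exact: addxx. Qed.
HB.instance Definition _ := isBoolModule.Build (M * N)%type pair_addxx.
End PairBoolModule.

(* Submodules of M are the library's addrClosed predicates (containing 0 and
   closed under +); submod S is S as a B-module in its own right. *)
Definition submod (M : bmodType) (S : addrClosed M) : Type := {x : M | x \in S}.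

Section SubBoolModule.
Variables (M : bmodType) (S : addrClosed M).
HB.instance Definition _ := SubChoice.on (submod S).
Let sub_closed : GRing.addr_closed (fun x : M => x \in S).
Proof. by split=> [|x y]; [exact: rpred0 | exact: rpredD]. Qed.
HB.instance Definition _ :=
  GRing.SubChoice_isSubNmodule.Build M _ (submod S) sub_closed.
Let sub_addxx (x : submod S) : x + x = x.
Proof. by apply: val_inj; rewrite raddfD addxx. Qed.
HB.instance Definition _ := isBoolModule.Build (submod S) sub_addxx.
End SubBoolModule.

Lemma bhom_ext (M N : bmodType) (f g : {additive M -> N}) : f =1 g -> f = g.
Proof.
move: f g => [f [[fP]]] [g [[gP]]] /= /funext fg.
by move: fP gP; rewrite fg => fP gP; rewrite (Prop_irrelevance fP gP).
Qed.

Definition zero_hom (M N : bmodType) : {additive M -> N} := \0.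

Record hom2 (M N : bmodType) := Hom2 {
  hom2_fst : {additive M -> N};
  hom2_snd : {additive M -> N}
}.

Definition comp2 (L M N : bmodType) (p : hom2 M N) (q : hom2 L M) : hom2 L N :=
  let: Hom2 f g := p in let: Hom2 f' g' := q in
  Hom2 ((f \o f') \+ (g \o g')) ((f \o g') \+ (g \o f')).

Definition id2 (M : bmodType) : hom2 M M := Hom2 idfun (zero_hom M M).

Definition zero2 (M N : bmodType) : hom2 M N :=
  Hom2 (zero_hom M N) (zero_hom M N).

Definition isomorphism2 (M N : bmodType) (p : hom2 M N) : Prop :=
  exists q : hom2 N M, comp2 q p = id2 M /\ comp2 p q = id2 N.

Lemma hom2_ext (M N : bmodType) (p q : hom2 M N) :
  hom2_fst p =1 hom2_fst q -> hom2_snd p =1 hom2_snd q -> p = q.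
Proof. by move: p q => [f g] [f' g'] /= /bhom_ext-> /bhom_ext->. Qed.

Lemma comp2A (K L M N : bmodType)
    (p : hom2 M N) (q : hom2 L M) (r : hom2 K L) :
  comp2 p (comp2 q r) = comp2 (comp2 p q) r.
Proof.
case: p q r => [f g] [f' g'] [f'' g'']; apply: hom2_ext => x /=;
  by rewrite !raddfD [X in _ + X = _]addrC addrACA.
Qed.

Lemma comp2_idl (M N : bmodType) (p : hom2 M N) : comp2 (id2 N) p = p.
Proof. by case: p => f g; apply: hom2_ext => x /=; rewrite addr0. Qed.

Lemma comp2_idr (M N : bmodType) (p : hom2 M N) : comp2 p (id2 M) = p.
Proof.
case: p => f g; apply: hom2_ext => x /=; first by rewrite raddf0 addr0.
by rewrite raddf0 add0r.
Qed.

Section StrictExactness.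
Variables L M N : bmodType.

(* boundary2, cycle2 and diagonal are B(a1, a2), Z(b1, b2) and Delta. *)
Definition boundary2 (a : hom2 L M) : set (M * M) :=
  [set (hom2_fst a x + hom2_snd a y, hom2_snd a x + hom2_fst a y)
     | x in [set: L] & y in [set: L]].

Definition cycle2 (b : hom2 M N) : set (M * M) :=
  [set w | hom2_fst b w.1 + hom2_snd b w.2 = hom2_snd b w.1 + hom2_fst b w.2].

Definition diagonal : set (M * M) := [set (x, x) | x in [set: M]].

Definition strictly_exact_at (a : hom2 L M) (b : hom2 M N) : Prop :=
  [set u + d | u in boundary2 a & d in diagonal] = cycle2 b.

End StrictExactness.

(* Strict exactness of K => L => M => N, at both intermediate terms. *)
Definition strictly_exact (K L M N : bmodType)
    (a : hom2 K L) (b : hom2 L M) (c : hom2 M N) : Prop :=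
  strictly_exact_at a b /\ strictly_exact_at b c.

Definition invertible (E : monoidType) (x : E) : Prop :=
  exists y : E, (y * x = 1 /\ x * y = 1)%g.

Record unit_group (E : monoidType) := UnitGroup {
  ug_val : E;
  ug_valP : `[< invertible ug_val >]
}.

Section UnitGroup.
Variable E : monoidType.
Implicit Types x y : unit_group E.
Local Open Scope group_scope.

HB.instance Definition _ := [isSub for @ug_val E].
HB.instance Definition _ := [Choice of unit_group E by <:].

Let ug_inverse x : {y : E | y * ug_val x = 1 /\ ug_val x * y = 1}.
Proof. by apply: cid; apply/asboolP; exact: ug_valP. Qed.

Let one_subproof : `[< invertible (1 : E) >].
Proof. by apply/asboolP; exists 1; rewrite mulg1. Qed.

Let mul_subproof x y : `[< invertible (ug_val x * ug_val y) >].
Proof.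
have [x' [x'x xx']] := ug_inverse x; have [y' [y'y yy']] := ug_inverse y.
apply/asboolP; exists (y' * x'); split.
  by rewrite -mulgA (mulgA x') x'x mul1g.
by rewrite -mulgA (mulgA (ug_val y)) yy' mul1g.
Qed.

Let inv_subproof x : `[< invertible (sval (ug_inverse x)) >].
Proof. by apply/asboolP; case: (ug_inverse x) => y [? ?]; exists (ug_val x). Qed.

Let one := UnitGroup one_subproof.
Let mul x y := UnitGroup (mul_subproof x y).
Let inv x := UnitGroup (inv_subproof x).

Let mulA : associative mul.
Proof. by move=> x y z; apply: val_inj; exact: mulgA. Qed.
Let mul1 : left_id one mul.
Proof. by move=> x; apply: val_inj; exact: mul1g. Qed.
Let mulr1 : right_id one mul.
Proof. by move=> x; apply: val_inj; exact: mulg1. Qed.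
Let mulV : left_inverse one inv mul.
Proof. by move=> x; apply: val_inj => /=; case: (ug_inverse x) => y []. Qed.
Let mulrV : right_inverse one inv mul.
Proof. by move=> x; apply: val_inj => /=; case: (ug_inverse x) => y []. Qed.

HB.instance Definition _ :=
  isGroup.Build (unit_group E) mulA mul1 mulr1 mulV mulrV.

Lemma ug_valM x y : ug_val (x * y) = ug_val x * ug_val y. Proof. by []. Qed.
Lemma ug_val1 : ug_val (1 : unit_group E) = 1. Proof. by []. Qed.

End UnitGroup.

Definition bmod_end (M : bmodType) : Type := {additive M -> M}.

Section BmodEnd.
Variable M : bmodType.
HB.instance Definition _ := gen_eqMixin (bmod_end M).
HB.instance Definition _ := gen_choiceMixin (bmod_end M).
Let one : bmod_end M := (idfun : {additive M -> M}).
Let mul (f g : bmod_end M) : bmod_end M :=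
  ((f : {additive M -> M}) \o (g : {additive M -> M}) : {additive M -> M}).
Let mulA : associative mul. Proof. by move=> f g h; exact: bhom_ext. Qed.
Let mul1 : left_id one mul. Proof. by move=> f; exact: bhom_ext. Qed.
Let mulr1 : right_id one mul. Proof. by move=> f; exact: bhom_ext. Qed.
HB.instance Definition _ := isMonoid.Build (bmod_end M) mulA mul1 mulr1.
End BmodEnd.

Definition bmod2_end (M : bmodType) : Type := hom2 M M.

Section Bmod2End.
Variable M : bmodType.
HB.instance Definition _ := gen_eqMixin (bmod2_end M).
HB.instance Definition _ := gen_choiceMixin (bmod2_end M).
HB.instance Definition _ := isMonoid.Build (bmod2_end M)
  (@comp2A M M M M) (@comp2_idl M M) (@comp2_idr M M).
End Bmod2End.

Definition aut (M : bmodType) : groupType := unit_group (bmod_end M).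
Definition aut2 (M : bmodType) : groupType := unit_group (bmod2_end M).

Section AutEmbedding.
Variable M : bmodType.

Definition end_incl (f : bmod_end M) : bmod2_end M := Hom2 f (zero_hom M M).

Lemma end_incl1 : end_incl 1%g = 1%g. Proof. by []. Qed.

Lemma end_inclM (f g : bmod_end M) :
  end_incl (f * g)%g = (end_incl f * end_incl g)%g.
Proof.
apply: hom2_ext => x /=; first by rewrite addr0.
by rewrite raddf0 addr0.
Qed.

Lemma aut_incl_subproof (a : aut M) : `[< invertible (end_incl (ug_val a)) >].
Proof.
case: a => f fP /=; case/asboolP: (fP) => g [gf fg].
by apply/asboolP; exists (end_incl g); rewrite -!end_inclM gf fg.
Qed.

Definition aut_incl (a : aut M) : aut2 M := UnitGroup (aut_incl_subproof a).

Lemma aut_inclM : {morph aut_incl : a b / (a * b)%g}.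
Proof. by move=> a b; apply: val_inj; exact: end_inclM. Qed.

End AutEmbedding.

Section Decompositions.
Variable M : bmodType.

Section SubmodSum.
Variables S1 S2 : addrClosed M.

Definition submod_sum (x : submod S1 * submod S2) : M := val x.1 + val x.2.

Let submod_sum_morph : nmod_morphism submod_sum.
Proof.
split=> [|x y]; rewrite /submod_sum; first by rewrite !raddf0 addr0.
by rewrite !raddfD addrACA.
Qed.
HB.instance Definition _ := GRing.isNmodMorphism.Build
  (submod S1 * submod S2)%type M submod_sum submod_sum_morph.
End SubmodSum.

(* dec_split is the inverse, in Bmod, of the sum map M1 * M2 -> M. *)
Record decomposition := Decomposition {
  dec_fst : addrClosed M;
  dec_snd : addrClosed M;
  dec_split : {additive M -> submod dec_fst * submod dec_snd};
  dec_sumK : cancel (@submod_sum dec_fst dec_snd) dec_split;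
  dec_splitK : cancel dec_split (@submod_sum dec_fst dec_snd)
}.

Definition dec_proj1 (D : decomposition) : {additive M -> M} :=
  val \o (fst \o dec_split D).
Definition dec_proj2 (D : decomposition) : {additive M -> M} :=
  val \o (snd \o dec_split D).

Definition dec_hom (D : decomposition) : hom2 M M :=
  Hom2 (dec_proj1 D) (dec_proj2 D).


Definition projectors (p : hom2 M M) : Prop :=
  let: Hom2 p1 p2 := p in
  [/\ forall x, p1 (p1 x) = p1 x, forall x, p2 (p2 x) = p2 x,
      forall x, p1 (p2 x) = 0, forall x, p2 (p1 x) = 0 &
      forall x, p1 x + p2 x = x].

Lemma dec_homP (D : decomposition) : projectors (dec_hom D).
Proof.
case: D => S1 S2 s sumK sK /=.
have s1 (a : submod S1) : s (val a) = (a, 0).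
  by rewrite -[RHS]sumK /submod_sum /= addr0.
have s2 (a : submod S2) : s (val a) = (0, a).
  by rewrite -[RHS]sumK /submod_sum /= add0r.
by split=> x; rewrite /= ?s1 ?s2 ?raddf0 //; exact: sK.
Qed.

Section FixedSubmodule.
Variable p : {additive M -> M}.
Definition fixed_by : {pred M} := fun x => p x == x.
Let fixed_closed : GRing.addr_closed fixed_by.
Proof.
split; first by rewrite unfold_in raddf0.
by move=> x y /eqP px /eqP py; rewrite unfold_in raddfD px py.
Qed.
HB.instance Definition _ := GRing.isAddClosed.Build M fixed_by fixed_closed.
End FixedSubmodule.

Lemma projectors_dec (p : hom2 M M) :
  projectors p -> exists D : decomposition, p = dec_hom D.
Proof.
case: p => p1 p2 /= [p11 p22 p12 p21 pE].
have f1 x : p1 x \in fixed_by p1 by rewrite unfold_in p11.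
have f2 x : p2 x \in fixed_by p2 by rewrite unfold_in p22.
pose s x : submod (fixed_by p1) * submod (fixed_by p2) :=
  (Sub (p1 x) (f1 x), Sub (p2 x) (f2 x)).
have s_morph : nmod_morphism s.
  by split=> [|x y]; congr pair; apply: val_inj;
    rewrite /= ?raddf0 ?raddfD //= raddf0.
pose s' : {additive M -> submod (fixed_by p1) * submod (fixed_by p2)} :=
  HB.pack s (GRing.isNmodMorphism.Build _ _ s s_morph).
have sumK : cancel (@submod_sum (fixed_by p1) (fixed_by p2)) s'.
  move=> [[x xP] [y yP]]; rewrite /= /s /submod_sum /=.
  have px : p1 x = x by apply/eqP.
  have py : p2 y = y by apply/eqP.
  congr pair; apply: val_inj; rewrite /= raddfD.
    by rewrite -py p12 addr0.
  by rewrite -px p21 add0r.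
have sK : cancel s' (@submod_sum (fixed_by p1) (fixed_by p2)).
  by move=> x; rewrite /= /s /submod_sum /= pE.
by exists (Decomposition sumK sK); exact: hom2_ext.
Qed.

Lemma dec_hom_sq (D : decomposition) :
  comp2 (dec_hom D) (dec_hom D) = id2 M.
Proof.
have := dec_homP D; case: (dec_hom D) => p1 p2 [p11 p22 p12 p21 pE].
by apply: hom2_ext => x /=; rewrite ?p11 ?p22 ?pE // p12 p21 addr0.
Qed.

Lemma dec_aut_subproof (D : decomposition) :
  `[< invertible (dec_hom D : bmod2_end M) >].
Proof. by apply/asboolP; exists (dec_hom D); split; exact: dec_hom_sq. Qed.

Definition dec_aut (D : decomposition) : aut2 M :=
  UnitGroup (dec_aut_subproof D).

Definition aut1_pred : {pred aut2 M} :=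
  fun x => `[< exists D : decomposition, x = dec_aut D >].

Lemma aut1P (x : aut2 M) : x \in aut1_pred <-> projectors (ug_val x).
Proof.
split=> [/asboolP[D ->]|/projectors_dec[D xD]]; first exact: dec_homP.
by apply/asboolP; exists D; exact: val_inj.
Qed.

(* Two decompositions have commuting projections: q x <= x for the natural
   order, and the summands of a decomposition are lower sets. *)
Lemma projectors_comp (p q : hom2 M M) :
  projectors p -> projectors q -> projectors (comp2 p q).
Proof.
have eq0 (x y : M) : x + y = 0 -> x = 0.
  by move=> xy0; rewrite -[LHS]addr0 -xy0 addrA addxx.
have com (a b c d : {additive M -> M}) : (forall x, a (b x) = 0) ->
    (forall x, b (a x) = 0) -> (forall x, a x + b x = x) ->
    (forall x, a (a x) = a x) -> (forall x, c x + d x = x) ->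
    forall x, a (c x) = c (a x).
  move=> ab ba abE aa cdE x.
  have bca y : b (c (a y)) = 0.
    by apply: (eq0 _ (b (d (a y)))); rewrite -raddfD cdE.
  have acb y : a (c (b y)) = 0.
    by apply: (eq0 _ (a (d (b y)))); rewrite -raddfD cdE.
  by rewrite -{1}(abE x) !raddfD acb addr0 -[RHS]abE bca addr0.
case: p q => [p1 p2] [q1 q2] [p11 p22 p12 p21 pE] [q11 q22 q12 q21 qE].
have pE' x : p2 x + p1 x = x by rewrite addrC.
have qE' x : q2 x + q1 x = x by rewrite addrC.
have c11 := com p1 p2 q1 q2 p12 p21 pE p11 qE.
have c12 := com p1 p2 q2 q1 p12 p21 pE p11 qE'.
have c21 := com p2 p1 q1 q2 p21 p12 pE' p22 qE.
have c22 := com p2 p1 q2 q1 p21 p12 pE' p22 qE'.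
have cE := (c11, c12, c21, c22).
have pq := (p11, p22, p12, p21, q11, q22, q12, q21).
split=> x /=.
- by rewrite !raddfD !cE !pq ?raddf0 ?addr0 ?add0r.
- by rewrite !raddfD !cE !pq ?raddf0 ?addr0 ?add0r.
- by rewrite !raddfD !cE !pq ?raddf0 ?addr0.
- by rewrite !raddfD !cE !pq ?raddf0 ?addr0.
- by rewrite addrACA -!raddfD qE qE' pE.
Qed.

Lemma aut1_sqr (x : aut2 M) : x \in aut1_pred -> (x * x = 1)%g.
Proof. by move=> /asboolP[D ->]; apply: val_inj; exact: dec_hom_sq. Qed.

Lemma aut1_closed : group_closed aut1_pred.
Proof.
split=> [|x y xA yA].
  by apply/aut1P; split=> z /=; rewrite ?addr0.
have -> : (y^-1 = y)%g by rewrite -[LHS]mulg1 -(aut1_sqr yA) mulgA mulVg mul1g.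
by apply/aut1P; apply: projectors_comp; apply/aut1P.
Qed.

Definition aut1_carrier : Type := {x : aut2 M | x \in aut1_pred}.
HB.instance Definition _ := SubChoice.on aut1_carrier.
HB.instance Definition _ := SubChoice_isSubGroup.Build (aut2 M) _ aut1_carrier
  aut1_closed.

Definition aut1 : groupType := aut1_carrier.
Definition aut1_incl (d : aut1) : aut2 M := val (d : aut1_carrier).

Lemma conj_aut1 (a : aut M) (d : aut1) :
  (aut_incl a * aut1_incl d * (aut_incl a)^-1)%g \in aut1_pred.
Proof.
have aE : ((aut_incl a)^-1 = aut_incl a^-1)%g.
  apply: (mulgI (aut_incl a)); rewrite mulgV -aut_inclM mulgV.
  exact: val_inj.
rewrite aE; have aV x : ug_val a (ug_val a^-1%g x) = x.
  have : ug_val (a * a^-1)%g = ug_val (1%g : aut M) by rewrite mulgV.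
  by move=> /(congr1 (fun f : {additive M -> M} => f x)).
have Va x : ug_val a^-1%g (ug_val a x) = x.
  have : ug_val (a^-1 * a)%g = ug_val (1%g : aut M) by rewrite mulVg.
  by move=> /(congr1 (fun f : {additive M -> M} => f x)).
case: d => d dA; rewrite /aut1_incl /=; apply/aut1P => /=.
move/aut1P: dA; case: (ug_val d) => p1 p2 [p11 p22 p12 p21 pE].
rewrite /= in aV Va.
split=> x /=; rewrite !raddf0 ?addr0 ?add0r ?Va ?p11 ?p22 ?p12 ?p21 ?raddf0 //.
by rewrite -raddfD pE aV.
Qed.

Definition conj_fun (a : aut M) (d : aut1) : aut1 :=
  exist (fun x => x \in aut1_pred) _ (conj_aut1 a d).

End Decompositions.

Record group_aut_action (H N : groupType) := GroupAutAction {
  gact :> H -> N -> N;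
  gactM : forall h, {morph gact h : x y / (x * y)%g};
  gact1 : forall x, gact 1%g x = x;
  gactA : forall h k x, gact (h * k)%g x = gact h (gact k x)
}.

(* N x| H with product (n, h)(n', h') = (n * h(n'), h h'). *)
Record semidirect (H N : groupType) (act : group_aut_action H N) := Semidirect {
  sd_normal : N;
  sd_acting : H
}.

Section SemidirectGroup.
Variables (H N : groupType) (act : group_aut_action H N).
Local Notation G := (semidirect act).
Local Open Scope group_scope.

HB.instance Definition _ := gen_eqMixin G.
HB.instance Definition _ := gen_choiceMixin G.

Let one : G := Semidirect act 1 1.
Let mul (u v : G) : G :=
  Semidirect act (sd_normal u * act (sd_acting u) (sd_normal v))
                 (sd_acting u * sd_acting v).
Let inv (u : G) : G :=
  Semidirect act (act (sd_acting u)^-1 (sd_normal u)^-1) (sd_acting u)^-1.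

Let act_1 h : act h 1 = 1.
Proof. by apply: (mulgI (act h 1)); rewrite -gactM !mulg1. Qed.

Let mulA : associative mul.
Proof.
by move=> [n h] [n' h'] [n'' h'']; rewrite /mul /= gactM gactA !mulgA.
Qed.
Let mul1 : left_id one mul.
Proof. by move=> [n h]; rewrite /mul /= gact1 !mul1g. Qed.
Let mulr1 : right_id one mul.
Proof. by move=> [n h]; rewrite /mul /= act_1 !mulg1. Qed.
Let mulV : left_inverse one inv mul.
Proof. by move=> [n h]; rewrite /mul /= -gactM !mulVg act_1. Qed.
Let mulrV : right_inverse one inv mul.
Proof. by move=> [n h]; rewrite /mul /= -gactA !mulgV gact1 mulgV. Qed.

HB.instance Definition _ := isGroup.Build G mulA mul1 mulr1 mulV mulrV.
End SemidirectGroup.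

Section ConjugationAction.
Variable M : bmodType.
Local Open Scope group_scope.

Let conjM (a : aut M) : {morph @conj_fun M a : x y / x * y}.
Proof.
move=> x y; apply: val_inj => /=; rewrite /aut1_incl /=.
by rewrite !mulgA mulgVK.
Qed.
Let aut_incl1 : aut_incl (1 : aut M) = 1. Proof. exact: val_inj. Qed.
Let conj1 (x : aut1 M) : conj_fun 1 x = x.
Proof. by apply: val_inj; rewrite /= aut_incl1 mul1g invg1 mulg1. Qed.
Let conjA (a b : aut M) (x : aut1 M) :
  conj_fun (a * b) x = conj_fun a (conj_fun b x).
Proof. by apply: val_inj; rewrite /= aut_inclM invgM /aut1_incl /= !mulgA. Qed.

Definition conj_act : group_aut_action (aut M) (aut1 M) :=
  GroupAutAction conjM conj1 conjA.

(* The canonical map (d, alpha) |-> d o (alpha, 0). *)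
Definition sd_to_aut2 (u : semidirect conj_act) : aut2 M :=
  aut1_incl (sd_normal u) * aut_incl (sd_acting u).

End ConjugationAction.

(* Main.v *)
(** Sums in a B-module vanish only termwise, so [(f', g')] is inverse to
    [(f, g)] iff [f' f + g' g] and [f f' + g g'] are identities and the mixed
    composites [f' g], [g' f], [f g'], [g f'] are all zero. Strict exactness
    says that [f u + g v = g u + f v] forces [u = v], and (from its values on
    pairs [(x, 0)]) that every [x] is [f a + g b] with [a] in [ker g] and [b]
    in [ker f]. The first property makes [(a, b)] unique and forces
    [M = ker g + ker f]; hence [x |-> (a, b)] is the inverse pair. For (ii), an
    automorphism [(f, g)] with inverse [(f', g')] is the decomposition
    [(f f', g g')] composed with the automorphism [f + g], whose inverse is
    [f' + g']. *)
Require Import Defs.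
From HB Require Import structures.
From mathcomp Require Import all_boot ssralg boolp classical_sets.

Set Implicit Arguments.
Unset Strict Implicit.
Unset Printing Implicit Defensive.

Import GRing.Theory.
Local Open Scope classical_set_scope.
Local Open Scope ring_scope.

Lemma bmod_add_eq0 (M : bmodType) (x y : M) : x + y = 0 -> x = 0 /\ y = 0.
Proof.
move=> xy0; split; last by rewrite -[LHS]add0r -xy0 -addrA addxx.
by rewrite -[LHS]addr0 -xy0 addrA addxx.
Qed.

Lemma comp2_id2P (M N : bmodType) (f g : {additive M -> N})
    (f' g' : {additive N -> M}) :
  comp2 (Hom2 f' g') (Hom2 f g) = id2 M <->
  [/\ forall x, f' (f x) + g' (g x) = x, forall x, f' (g x) = 0 &
      forall x, g' (f x) = 0].
Proof.
split=> [E|[fg1 fg0 gf0]]; last first.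
  by apply: hom2_ext => x /=; rewrite ?fg1 // fg0 gf0 addr0.
have E1 x : f' (f x) + g' (g x) = x.
  exact: (congr1 (fun p => hom2_fst p x) E).
have E2 x : f' (g x) + g' (f x) = 0.
  exact: (congr1 (fun p => hom2_snd p x) E).
by split=> // x; have [] := bmod_add_eq0 (E2 x).
Qed.

(** The zero pair has boundary [{(0, 0)}], so exactness at [M] says that the cycles are diagonal.
    Every pair in [N * N] is a cycle of the zero pair, so exactness at [N] is a generation
    property. *)
Lemma strictly_exact_pairP (M N : bmodType) (f g : {additive M -> N}) :
  strictly_exact (zero2 zero_bmod M) (Hom2 f g) (zero2 N zero_bmod) <->
  (forall u v, f u + g v = g u + f v -> u = v) /\
  (forall x y, exists u v d, x = f u + g v + d /\ y = g u + f v + d).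
Proof.
split=> [[exM exN]|[inj gen]]; split.
- move=> u v uv; have : cycle2 (Hom2 f g) (u, v) by [].
  rewrite -exM => -[_ [x _ [y _ <-]] [_ [d _ <-]] E].
  by have /= <- := congr1 fst E; have /= <- := congr1 snd E.
- move=> x y; have : cycle2 (zero2 N zero_bmod) (x, y) by [].
  rewrite -exN => -[_ [u _ [v _ <-]] [_ [d _ <-]] E].
  have /= <- := congr1 fst E; have /= <- := congr1 snd E.
  by exists u, v, d.
- apply/seteqP; split=> [_ [_ [x _ [y _ <-]] [_ [d _ <-]] <-]|[u v] /inj /= ->].
    by rewrite /cycle2 /= addr0 addrC.
  exists (0, 0); first by exists tt => //; exists tt => //; rewrite /= addr0.
  by exists (v, v); [exists v | rewrite -[RHS]add0r].
- apply/seteqP; split=> // -[x y] _; have [u [v [d [-> ->]]]] := gen x y.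
  exists (f u + g v, g u + f v); first by exists u => //; exists v.
  by exists (d, d) => //; exists d.
Qed.

Section ExactIsomorphism.
Variables (M N : bmodType) (f g : {additive M -> N}).

Lemma isomorphism2_exact : isomorphism2 (Hom2 f g) ->
  strictly_exact (zero2 zero_bmod M) (Hom2 f g) (zero2 N zero_bmod).
Proof.
move=> [[f' g'] [/comp2_id2P[E f'g g'f] /comp2_id2P[E' fg' gf']]].
apply/strictly_exact_pairP; split=> [u v uv|x y].
  (* [f'] kills the [g] terms and [g'] the [f] terms, leaving [f' f u = f' f v] and
     [g' g v = g' g u]. *)
  have := congr1 f' uv; have := congr1 g' uv.
  rewrite !raddfD !f'g !g'f add0r addr0 addr0 add0r => guv fuv.
  by rewrite -[u]E fuv -guv E.
exists (f' x + g' y), (g' x + f' y), 0; rewrite !raddfD !fg' !gf'.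
by rewrite !addr0 !add0r E' addrC E'.
Qed.

Hypothesis inj : forall u v, f u + g v = g u + f v -> u = v.
Hypothesis gen : forall x y, exists u v d,
  x = f u + g v + d /\ y = g u + f v + d.

Lemma exact_kernel_sum (x : N) :
  exists ab : M * M, [/\ x = f ab.1 + g ab.2, g ab.1 = 0 & f ab.2 = 0].
Proof.
(* The second coordinate [g u + f v + d] is [0], so its three terms vanish. *)
have [u [v [d [-> /esym/bmod_add_eq0[/bmod_add_eq0[gu fv] ->]]]]] := gen x 0.
by exists (u, v); rewrite addr0.
Qed.

Lemma exact_kernel_sum_inj (a b a' b' : M) :
  g a = 0 -> f b = 0 -> g a' = 0 -> f b' = 0 ->
  f a + g b = f a' + g b' -> a = a' /\ b = b'.
Proof.
move=> ga fb ga' fb' E.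
(* On these crossed sums the hypothesis of [inj] reduces to [E]. *)
have E1 : a + b' = a' + b.
  by apply: inj; rewrite !raddfD ga ga' fb fb' addr0 !add0r addr0 E addrC.
have fE : f a = f a' by have := congr1 f E1; rewrite !raddfD fb fb' !addr0.
have gE : g b' = g b by have := congr1 g E1; rewrite !raddfD ga ga' !add0r.
by split; apply: inj; rewrite ?ga ?ga' ?fb ?fb' ?addr0 ?add0r.
Qed.

(* For the order [x <= y :<-> x + y = y] of a B-module: [f + g] reflects it. *)
Lemma exact_le_reflect (b m : M) :
  f b + (f m + g m) = f m + g m -> g b + (f m + g m) = f m + g m -> b + m = m.
Proof.
move=> fb gb; apply: inj.
by rewrite !raddfD -addrA fb -addrA [g m + f m]addrC gb.
Qed.

(** Split both [f m] and [g m]; [m] is the [ker g] part [a] of the first plus the [ker f] part [b']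
    of the second. The leftover parts [b] and [a'] lie below [m], so [g b] is absorbed by [g m] and
    [f a'] by [f m]. *)
Lemma exact_domain_sum (m : M) :
  exists a b, [/\ m = a + b, g a = 0 & f b = 0].
Proof.
have [[a b] /= [fmE ga fb]] := exact_kernel_sum (f m).
have [[a' b'] /= [gmE ga' fb']] := exact_kernel_sum (g m).
have gbf : g b + f m = f m by rewrite fmE addrCA addxx.
have faf : f a' + g m = g m by rewrite gmE addrA addxx.
have /(congr1 g) : b + m = m.
  by apply: exact_le_reflect; rewrite ?fb ?add0r // addrA gbf.
have /(congr1 f) : a' + m = m.
  by apply: exact_le_reflect; rewrite ?ga' ?add0r // addrCA faf.
rewrite !raddfD => a'm bm.
exists a, b'; split=> //; apply: inj; rewrite !raddfD ga fb' add0r addr0.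
(* Both sides equal [g m + f a]. *)
by rewrite -{1}a'm addrAC -gmE fmE addrCA [g m + g b]addrC bm addrC.
Qed.

Lemma exact_isomorphism2 : isomorphism2 (Hom2 f g).
Proof.
pose s x := sval (cid (exact_kernel_sum x)).
have sP x : [/\ x = f (s x).1 + g (s x).2, g (s x).1 = 0 & f (s x).2 = 0].
  exact: (svalP (cid (exact_kernel_sum x))).
(* Uniqueness identifies the chosen pair with any other valid one; additivity of [s] and its values
   on the images of [f] and [g] follow. *)
have sE a b x : g a = 0 -> f b = 0 -> x = f a + g b -> s x = (a, b).
  move=> ga fb xE; have [xE' gs fs] := sP x; rewrite [LHS]surjective_pairing.
  by have [|-> ->] := exact_kernel_sum_inj gs fs ga fb; rewrite -?xE'.
have s0 : s 0 = 0 by apply: sE; rewrite ?raddf0 ?addr0.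
have sD x y : s (x + y) = s x + s y.
  have [xE gx fx] := sP x; have [yE gy fy] := sP y.
  rewrite [RHS]surjective_pairing; apply: sE; rewrite ?raddfD.
  - by rewrite gx gy addr0.
  - by rewrite fx fy addr0.
  - by rewrite /= addrACA -xE -yE.
have f'_morph : nmod_morphism (fst \o s).
  by split=> [|x y] /=; rewrite ?s0 ?sD.
have g'_morph : nmod_morphism (snd \o s).
  by split=> [|x y] /=; rewrite ?s0 ?sD.
pose f' : {additive N -> M} :=
  HB.pack (fst \o s) (GRing.isNmodMorphism.Build _ _ _ f'_morph).
pose g' : {additive N -> M} :=
  HB.pack (snd \o s) (GRing.isNmodMorphism.Build _ _ _ g'_morph).
have sf a b : g a = 0 -> f b = 0 -> s (f (a + b)) = (a, 0).
  by move=> ga fb; apply: sE; rewrite // ?raddfD ?raddf0 ?fb.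
have sg a b : g a = 0 -> f b = 0 -> s (g (a + b)) = (0, b).
  by move=> ga fb; apply: sE; rewrite // ?raddfD ?raddf0 ?ga ?add0r.
exists (Hom2 f' g'); split; apply/comp2_id2P.
  by split=> m; have [a [b [-> ga fb]]] := exact_domain_sum m;
    rewrite /= ?sf ?sg.
by split=> x /=; have [] := sP x.
Qed.

End ExactIsomorphism.

Lemma isomorphism2_exactP (M N : bmodType) (f g : {additive M -> N}) :
  strictly_exact (zero2 zero_bmod M) (Hom2 f g) (zero2 N zero_bmod) <->
  isomorphism2 (Hom2 f g).
Proof.
split; last exact: isomorphism2_exact.
by move=> /strictly_exact_pairP[inj gen]; exact: exact_isomorphism2.
Qed.

Section AutSemidirect.
Variable M : bmodType.

Lemma aut1_mulgg (d : aut1 M) : (d * d = 1)%g.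
Proof. by apply: val_inj; apply: aut1_sqr; exact: valP. Qed.

Lemma sd_to_aut2M : {morph @sd_to_aut2 M : u v / (u * v)%g}.
Proof.
move=> [d a] [d' a']; rewrite /sd_to_aut2 /= aut_inclM /aut1_incl /=.
by rewrite /aut1_incl !mulgA mulgVK.
Qed.

Lemma sd_to_aut2E (u : semidirect (conj_act M)) (x : M) :
  let: Hom2 p1 p2 := ug_val (aut1_incl (sd_normal u)) in
  hom2_fst (ug_val (sd_to_aut2 u)) x = p1 (ug_val (sd_acting u) x) /\
  hom2_snd (ug_val (sd_to_aut2 u)) x = p2 (ug_val (sd_acting u) x).
Proof.
rewrite /sd_to_aut2 ug_valM /=; case: (ug_val (aut1_incl _)) => p1 p2 /=.
by rewrite !raddf0 addr0 add0r.
Qed.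

(** As [p1 + p2 = id], adding the two components recovers the acting factor; injectivity rests on
    this. *)
Lemma sd_to_aut2_acting (u : semidirect (conj_act M)) (x : M) :
  ug_val (sd_acting u) x =
  hom2_fst (ug_val (sd_to_aut2 u)) x + hom2_snd (ug_val (sd_to_aut2 u)) x.
Proof.
have /aut1P := valP (sd_normal u); have := sd_to_aut2E u x.
rewrite /aut1_incl; case: (ug_val _) => p1 p2 [-> ->] [_ _ _ _ pE].
by rewrite pE.
Qed.

Lemma sd_to_aut2_inj : injective (@sd_to_aut2 M).
Proof.
move=> u v uv.
have Ea : sd_acting u = sd_acting v.
  by apply: val_inj; apply: bhom_ext => x; rewrite !sd_to_aut2_acting uv.
move: u v uv Ea => [d a] [d' a'] /= E aa'; rewrite -aa' in E *.
by congr Semidirect; apply: val_inj; apply: mulIg E.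
Qed.

Lemma sd_to_aut2_surj (x : aut2 M) : exists u, sd_to_aut2 u = x.
Proof.
case: x => -[f g] xP; have [[f' g']] := asboolW xP.
move=> [/comp2_id2P[E f'g g'f] /comp2_id2P[E' fg' gf']].
have aP : `[< invertible ((f \+ g : {additive M -> M}) : bmod_end M) >].
  apply/asboolP; exists (f' \+ g' : {additive M -> M}).
  split; apply: bhom_ext => x /=; rewrite !raddfD.
    by rewrite f'g g'f addr0 add0r E.
  by rewrite fg' gf' addr0 add0r E'.
have pP : projectors (Hom2 (f \o f') (g \o g')).
  split=> x /=; rewrite ?f'g ?g'f ?raddf0 ?E' //.
    (* Idempotence: [f' = f' f f' + g' g f'] and [g f' = 0]. *)
    by rewrite -{2}[f' x]E gf' raddf0 addr0.
  by rewrite -{2}[g' x]E fg' raddf0 add0r.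
have qP : `[< invertible (Hom2 (f \o f') (g \o g') : bmod2_end M) >].
  by have [D ->] := projectors_dec pP; exact: dec_aut_subproof.
have dP : UnitGroup qP \in aut1_pred (M := M) by apply/aut1P.
exists (Semidirect (conj_act M)
  (exist (fun x => x \in aut1_pred (M := M)) _ dP) (UnitGroup aP)).
(* [f f' (f + g) = f f' f], which is [f] because [f' f + g' g = id] and [f g' = 0]; likewise for
   [g]. *)
apply: val_inj; apply: hom2_ext => x /=.
  by rewrite !raddf0 !raddfD f'g !raddf0 !addr0 -{2}[x]E raddfD fg' addr0.
by rewrite !raddf0 !raddfD g'f !raddf0 !add0r -{2}[x]E raddfD gf' add0r.
Qed.

End AutSemidirect.

Theorem proposition4p12 :
  (forall (M N : bmodType) (f g : {additive M -> N}),
     strictly_exact (zero2 zero_bmod M) (Hom2 f g) (zero2 N zero_bmod) <->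
     isomorphism2 (Hom2 f g))
  /\
  (forall M : bmodType,
     (forall d : aut1 M, (d * d = 1)%g) /\
     {morph @sd_to_aut2 M : u v / (u * v)%g} /\
     bijective (@sd_to_aut2 M)).
Proof.
split=> [|M]; first exact: isomorphism2_exactP.
split; first exact: aut1_mulgg.
split; first exact: sd_to_aut2M.
pose s x := sval (cid (@sd_to_aut2_surj M x)).
have sK : cancel s (@sd_to_aut2 M).
  by move=> x; exact: (svalP (cid (@sd_to_aut2_surj M x))).
by exists s => // u; apply: sd_to_aut2_inj; exact: sK.
Qed.
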